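(* For all integers $n$, $r$ and $k$ with $n\ge r\ge 1$ and every real number $q$, $$\sum_{j=r}^n\left\{{n\atop j}\right\}_r c_j^{(k)}(q)=\sum_{\ell=1}^{r}(-1)^{r-\ell}\left[{r\atop \ell}\right]\sum_{i=0}^{n-r+\ell}\binom{n-r+\ell}{i}\frac{q^{n-r+\ell-i}}{(i+1)^k},$$ with the convention $q^0=1$.
   Context: For an integer $k$, the poly-Cauchy polynomials $c_n^{(k)}(z)$ are defined by $(1+x)^z\,\mathrm{Lif}_k(\log(1+x))=\sum_{n\ge0}c_n^{(k)}(z)x^n/n!$, where $\mathrm{Lif}_k(z)=\sum_{m\ge0}\frac{z^m}{m!(m+1)^k}$. $\left[{n\atop m}\right]$ denotes the unsigned Stirling number of the first kind, defined by $x(x+1)\cdots(x+n-1)=\sum_{m}\left[{n\atop m}\right]x^m$. For $r\ge 0$, the $r$-Stirling number of the second kind $\left\{{n\atop m}\right\}_r$ is the number of ways to partition $\{1,\dots,n\}$ into $m$ nonempty disjoint blocks such that $1,\dots,r$ lie in distinct blocks; equivalently $\left\{{n\atop m}\right\}_r=0$ for $n<r$, $\left\{{r\atop m}\right\}_r=\delta_{m,r}$, and $\left\{{n\atop m}\right\}_r=m\left\{{n-1\atop m}\right\}_r+\left\{{n-1\atop m-1}\right\}_r$ for $n>r$. *)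

(* Defs.v *)
From mathcomp Require Import all_boot all_order all_algebra.
From mathcomp Require Import reals.

Set Implicit Arguments.
Unset Strict Implicit.
Unset Printing Implicit Defensive.

Import Order.TTheory GRing.Theory Num.Theory.

Local Open Scope ring_scope.

(* A formal power series in x over A is its sequence of coefficients:
   a n is the coefficient of x^n. *)
Definition fps (A : Type) : Type := nat -> A.

Definition fps_one (A : nzRingType) : fps A := fun n => (n == 0%N)%:R.

Definition fps_mul (A : nzRingType) (a b : fps A) : fps A :=
  fun n => \sum_(i < n.+1) a i * b (n - i)%N.

Definition fps_exp (A : nzRingType) (a : fps A) (m : nat) : fps A :=
  iter m (fps_mul a) (fps_one A).

(* The substitution a(b(x)), meaningful when b has zero constant term; then
   b^m has no term of degree < m, so truncating the sum over m at n is exact. *)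
Definition fps_comp (A : nzRingType) (a b : fps A) : fps A :=
  fun n => \sum_(m < n.+1) a m * fps_exp b m n.

(* log(1 + x) = x - x^2/2 + x^3/3 - ... *)
Definition fps_log1p (R : realType) : fps {poly R} :=
  fun n => if n is m.+1 then ((-1) ^+ m / m.+1%:R)%:P else 0.

(* (1 + x)^z as the binomial series, with x^n-coefficient
   z(z - 1)...(z - n + 1)/n!; here z, the variable of the poly-Cauchy
   polynomials, is the indeterminate 'X of {poly R}. *)
Definition fps_1pX_pow_z (R : realType) : fps {poly R} :=
  fun n => n`!%:R^-1 *: \prod_(i < n) ('X - i%:R%:P).

Definition Lif (R : realType) (k : int) : fps {poly R} :=
  fun m => ((m`!%:R * m.+1%:R ^ k)^-1)%:P.

(* The generating function is exponential, whence the factor n!. *)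
Definition poly_cauchy (R : realType) (k : int) (n : nat) : {poly R} :=
  n`!%:R *: fps_mul (fps_1pX_pow_z R) (fps_comp (Lif R k) (fps_log1p R)) n.

Definition stirling1 (n m : nat) : nat :=
  ((\prod_(i < n) ('X + (i : nat)%:P) : {poly nat})`_m)%R.

(* 'I_n = {0, ..., n-1} stands for {1, ..., n}, so that the distinguished
   elements 1, ..., r are the i : 'I_n with i < r. For n < r the count is 0 by
   convention, whence the test r <= n. *)
Definition rstirling2 (r n m : nat) : nat :=
  #|[set P : {set {set 'I_n}} |
      [&& (r <= n)%N, partition P [set: 'I_n], #|P| == m &
          [forall i : 'I_n, forall j : 'I_n,
             [&& (i < r)%N, (j < r)%N & i != j] ==>
               (pblock P i != pblock P j)]]]|.

(* Main.v *)
Require Import Defs.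
From mathcomp Require Import all_boot all_order all_algebra.
From mathcomp Require Import reals ring.

(** Let L be the linear functional on polynomials in t with
    L(t^m) = 1/(m+1)^k. Since Lif_k(u) = L(e^(tu)), the generating function of
    the c_n^(k)(q) is L((1+x)^(q+t)), so that c_n^(k)(q) = L((q+t)_n), where
    (y)_n = y(y-1)...(y-n+1). Counting the maps from {1, ..., n} to a finite
    set that are injective on {1, ..., r}, according to the partition into
    fibers, gives
      sum_j {n j}_r (y)_j = y^(n-r) (y)_r.
    Take y = q + t, expand (y)_r in powers of y and apply L. *)

Set Implicit Arguments.
Unset Strict Implicit.
Unset Printing Implicit Defensive.

Import Order.TTheory GRing.Theory Num.Theory.

(** * Maps counted by their partition into fibers *)

Lemma card_ffun_injective_prefix (T : finType) r m :
  #|[set f : {ffun 'I_(r + m) -> T} | injectiveb [ffun i => f (lshift m i)]]| =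
  #|T| ^_ r * #|T| ^ m.
Proof.
pose split_fun (f : {ffun 'I_(r + m) -> T}) :=
  ([ffun i => f (lshift m i)], [ffun i => f (rshift r i)]).
pose join_fun (gh : {ffun 'I_r -> T} * {ffun 'I_m -> T}) :=
  [ffun i => match split i with inl a => gh.1 a | inr b => gh.2 b end].
have splitK : cancel split_fun join_fun.
  move=> f; apply/ffunP=> i; rewrite ffunE /=.
  by case: split_ordP => j ->; rewrite ffunE.
have joinK : cancel join_fun split_fun.
  move=> [g h]; congr (_, _); apply/ffunP=> i; rewrite !ffunE /=.
    by rewrite (unsplitK (inl i)).
  by rewrite (unsplitK (inr i)).
have -> : [set f : {ffun 'I_(r + m) -> T} | injectiveb [ffun i => f (lshift m i)]] =
    split_fun @^-1: setX [set g : {ffun 'I_r -> T} | injectiveb g] setT.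
  by apply/setP=> f; rewrite !inE andbT.
rewrite on_card_preimset; last by apply: onW_bij; exists join_fun.
by rewrite cardsX card_inj_ffuns cardsT card_ffun !card_ord.
Qed.

Lemma preim_partition_eqP (T X : finType) (f : T -> X) (P : {set {set T}}) :
  partition P [set: T] ->
  reflect (forall i j, (f i == f j) = (pblock P i == pblock P j))
          (preim_partition f [set: T] == P).
Proof.
move=> partP; have tiP := partition_trivIset partP.
have covP i : i \in cover P by rewrite (cover_partition partP) inE.
apply: (iffP eqP) => [<- i j | eqf].
  have /and3P[/eqP cvf tif _] := preim_partitionP f [set: T].
  rewrite eq_pblock ?cvf ?inE // pblock_equivalence_partition ?inE //.
  by move=> ? ? ? _ _ _ /=; split=> // /eqP->.
rewrite -[RHS](preim_partition_pblock partP).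
by apply: eq_imset => i; apply/setP=> j; rewrite !inE eqf.
Qed.

(** A map whose fibers are exactly the blocks of [P] factors uniquely through an injection from the
    set of blocks into [X]. *)
Lemma card_ffun_preim_partition (T X : finType) (P : {set {set T}}) :
  partition P [set: T] ->
  #|[set f : {ffun T -> X} | preim_partition f [set: T] == P]| = #|X| ^_ #|P|.
Proof.
move=> partP; have tiP := partition_trivIset partP.
have covP i : i \in cover P by rewrite (cover_partition partP) inE.
pose block i : {B | B \in P} := Sub (pblock P i) (pblock_mem (covP i)).
have repP (B : {B | B \in P}) : {i | block i = B}.
  have /set0Pn/sigW[i Bi] := partition_neq0 partP (valP B).
  by exists i; apply: val_inj; apply: def_pblock tiP (valP B) Bi.
pose lift_fun (g : {ffun {B | B \in P} -> X}) := [ffun i => g (block i)].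
have lift_inj : injective lift_fun.
  move=> g h /ffunP eq_gh; apply/ffunP=> B; have [i <-] := repP B.
  by have := eq_gh i; rewrite !ffunE.
rewrite (_ : [set f | _] = lift_fun @: [set g : {ffun _ -> X} | injectiveb g]); last first.
  apply/setP=> f; rewrite inE; apply/(preim_partition_eqP f partP)/imsetP.
    (* The injection takes on a block the value of [f] at a chosen representative. *)
    move=> eqf; exists [ffun B => f (sval (repP B))].
      rewrite inE; apply/injectiveP=> B C; rewrite !ffunE => /eqP.
      rewrite eqf; case: (repP B) (repP C) => [i Bi] [j Cj] /= /eqP eqB.
      by rewrite -Bi -Cj; apply: val_inj.
    apply/ffunP=> i; rewrite !ffunE; apply/eqP; rewrite eqf.
    by case: (repP (block i)) => j /= /(congr1 val) /= ->.
  case=> g; rewrite inE => /injectiveP g_inj -> i j.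
  by rewrite !ffunE (inj_eq g_inj).
by rewrite card_imset // card_inj_ffuns card_sig.
Qed.

(** A copy of the last clause of [rstirling2], named so that it can be folded there. *)
Definition separates (r n : nat) (P : {set {set 'I_n}}) : bool :=
  [forall i : 'I_n, forall j : 'I_n,
     [&& i < r, j < r & i != j] ==> (pblock P i != pblock P j)].

(** The first r points lie in distinct blocks, and nonempty blocks cannot outnumber the points.
    Hence the range r <= j <= n misses no separating partition. *)
Lemma card_separating_partition r n (P : {set {set 'I_n}}) : r <= n ->
  partition P [set: 'I_n] -> separates r P -> r <= #|P| <= n.
Proof.
move=> le_rn partP /forallP sepP; have tiP := partition_trivIset partP.
have covP i : i \in cover P by rewrite (cover_partition partP) inE.
apply/andP; split.
  rewrite -{1}[r]card_ord; pose f i := pblock P (widen_ord le_rn i).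
  have f_inj : injective f.
    move=> i j eq_ij; apply/eqP; apply: contraTT (eqxx (f i)) => ne_ij.
    rewrite {2}eq_ij; have /forallP/(_ (widen_ord le_rn j))/implyP := sepP (widen_ord le_rn i).
    by apply; rewrite /= !ltn_ord.
  rewrite -(card_imset _ f_inj); apply/subset_leq_card/subsetP=> _ /imsetP[i _ ->].
  exact: pblock_mem.
have : #|P| <= \sum_(B in P) #|B|.
  rewrite -sum1_card; apply: leq_sum => B BP.
  by rewrite card_gt0 (partition_neq0 partP).
by rewrite -(card_partition partP) cardsT card_ord.
Qed.

Lemma separates_preim_partition (X : finType) r m (f : {ffun 'I_(r + m) -> X}) :
  separates r (preim_partition f [set: 'I_(r + m)]) =
  injectiveb [ffun i => f (lshift m i)].
Proof.
have /(preim_partition_eqP f (preim_partitionP f _)) eqf := eqxx (preim_partition f setT).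
apply/forallP/injectiveP => [sepP i j | f_inj i].
  rewrite !ffunE => /eqP; rewrite eqf => eq_ij; apply/eqP.
  apply: contraTT eq_ij => ne_ij.
  have /forallP/(_ (lshift m j))/implyP := sepP (lshift m i); apply.
  by rewrite /= !ltn_ord.
apply/forallP=> j; apply/implyP=> /and3P[lt_ir lt_jr ne_ij].
rewrite -eqf; apply: contra ne_ij => /eqP eq_fij.
have eq_i : i = lshift m (Ordinal lt_ir) by apply: val_inj.
have eq_j : j = lshift m (Ordinal lt_jr) by apply: val_inj.
rewrite eq_i eq_j; apply/eqP; congr lshift.
by apply: f_inj; rewrite !ffunE -eq_i -eq_j.
Qed.

Lemma sum_rstirling2_ffact r n x : r <= n ->
  \sum_(r <= j < n.+1) rstirling2 r n j * x ^_ j = x ^_ r * x ^ (n - r).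
Proof.
move=> le_rn; have [m def_n] : exists m, n = r + m by exists (n - r); rewrite subnKC.
subst n; rewrite addKn -{2 3}[x]card_ord -card_ffun_injective_prefix -sum1_card.
pose kernel (f : {ffun 'I_(r + m) -> 'I_x}) := preim_partition f [set: 'I_(r + m)].
pose Q P := partition P [set: 'I_(r + m)] && separates r P.
(* The maps are grouped by their fiber partition; both sides become a sum over separating
   partitions. *)
rewrite (partition_big kernel Q) => [|f]; last first.
  by rewrite inE /Q preim_partitionP separates_preim_partition.
transitivity (\sum_(P | Q P) x ^_ #|P|); last first.
  apply: eq_bigr => P /andP[partP sepP].
  rewrite sum1dep_card -[x in LHS]card_ord -(card_ffun_preim_partition _ partP).
  apply: eq_card => f; rewrite !inE andbC -separates_preim_partition.
  by rewrite /kernel; case: eqP => // ->.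
under eq_bigr => j _.
  rewrite /rstirling2 -sum1dep_card big_distrl /=.
  under eq_bigl => P do rewrite le_rn /= -/(separates r P).
  over.
rewrite (exchange_big_dep Q) => [|j P _ /and3P[partP _ sepP]] /=; last exact/andP.
apply: eq_bigr => P QP; have [partP sepP] := andP QP.
under eq_bigl => j do rewrite partP sepP andbT eq_sym.
(* Only j = [#|P|] contributes for a given [P], and it lies in the range of summation. *)
have := card_separating_partition le_rn partP sepP.
by rewrite -ltnS => cardP; rewrite big_nat1_eq cardP mul1n.
Qed.

Local Open Scope ring_scope.

(** * Falling factorials and Stirling numbers of the first kind *)

Definition falling (A : nzRingType) (x : A) (n : nat) : A :=
  \prod_(i < n) (x - i%:R).

Lemma fallingS (A : nzRingType) (x : A) n :
  falling x n.+1 = falling x n * (x - n%:R).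
Proof. by rewrite /falling big_ord_recr. Qed.

Lemma falling_nat (A : nzRingType) (x n : nat) :
  @falling A x%:R n = (x ^_ n)%:R.
Proof.
elim: n => [|n IHn]; first by rewrite /falling big_ord0 ffactn0.
(* The natural subtraction [x - n] is truncated when x < n, but then [x ^_ n] is already 0. *)
rewrite fallingS IHn ffactnSr natrM; case: (leqP n x) => [le_nx|lt_xn].
  by rewrite natrB.
by rewrite ffact_small // !mul0r.
Qed.

Lemma rmorph_falling (A B : nzRingType) (f : {rmorphism A -> B}) x n :
  f (falling x n) = falling (f x) n.
Proof.
rewrite /falling rmorph_prod; apply: eq_bigr => i _.
by rewrite rmorphB rmorph_nat.
Qed.

Lemma horner_falling (A : comNzRingType) (p : {poly A}) n x :
  (falling p n).[x] = falling p.[x] n.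
Proof. exact: (rmorph_falling (horner_eval x)). Qed.

Lemma size_fallingX (A : nzRingType) n : size (falling ('X : {poly A}) n) = n.+1.
Proof.
rewrite /falling -(big_mkord xpredT (fun i => 'X - i%:R)).
under eq_bigr do rewrite -polyC_natr.
by rewrite size_prod_XsubC size_iota subn0.
Qed.

Lemma coef_fallingX0 (A : comNzRingType) n :
  (falling ('X : {poly A}) n)`_0 = (n == 0%N)%:R.
Proof.
case: n => [|n]; first by rewrite /falling big_ord0 coef1.
by rewrite /falling big_ord_recl subr0 coefXM.
Qed.

Lemma coef_fallingXS (A : nzRingType) n m :
  (falling ('X : {poly A}) n.+1)`_m.+1 =
  (falling 'X n)`_m - n%:R * (falling 'X n)`_m.+1.
Proof.
by rewrite fallingS mulrBr coefB coefMX -polyC_natr coefMC mulr_natr mulr_natl.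
Qed.

(** Up to sign, both sides obey the same recurrence. The exponent n + m has the parity of n - m and
    remains meaningful for m > n. *)
Lemma coef_fallingX (A : comNzRingType) n m :
  (falling ('X : {poly A}) n)`_m = (-1) ^+ (n + m) * (stirling1 n m)%:R.
Proof.
rewrite /stirling1; elim: n m => [|n IHn] m.
  by rewrite /falling !big_ord0 !coef1; case: m => [|m] /=; rewrite ?mulr1 ?mulr0.
rewrite big_ord_recr /= mulrDr coefD coefMX coefMC; case: m => [|m] /=.
  rewrite coef_fallingX0 /=; case: n IHn => [|n] IHn.
    by rewrite mulr0 addr0 mulr0.
  by rewrite big_ord_recl /= addr0 coefXM /= mul0r addr0 mulr0.
rewrite coef_fallingXS !IHn natrD natrM mulrDr addSn addnS !exprS; ring.
Qed.

Lemma falling_stirling1 (A : comNzRingType) (x : A) r : (0 < r)%N ->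
  falling x r =
  \sum_(1 <= l < r.+1) (-1) ^+ (r - l) * (stirling1 r l)%:R * x ^+ l.
Proof.
move=> r_gt0; pose F l := (falling ('X : {poly A}) r)`_l * x ^+ l.
have -> : falling x r = (falling 'X r).[x] by rewrite horner_falling hornerX.
(* The constant coefficient vanishes because r > 0, so the sum may start at l = 1. *)
rewrite horner_coef size_fallingX -(big_mkord xpredT F) big_ltn // {1}/F.
rewrite coef_fallingX0 eqn0Ngt r_gt0 mul0r add0r.
apply: eq_big_nat => l /andP[_ le_lr]; congr (_ * _).
rewrite coef_fallingX; congr (_ * _).
by rewrite -signr_odd oddD -oddB ?signr_odd.
Qed.

(** Vandermonde's identity: the induction combines Pascal's rule with x + y - n = (x - i) + (y - (n
    - i)) in the i-th term. *)
Lemma fallingD (A : comNzRingType) (x y : A) n :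
  falling (x + y) n = \sum_(i < n.+1) 'C(n, i)%:R * (falling x i * falling y (n - i)).
Proof.
elim: n => [|n IHn]; first by rewrite big_ord1 /falling !big_ord0 !mulr1.
pose F i := 'C(n, i)%:R * (falling x i * falling y (n.+1 - i)).
have sumF : \sum_(i < n.+1) F i = F 0%N + \sum_(i < n.+1) F i.+1.
  rewrite -(big_mkord xpredT F) -(big_mkord xpredT (fun i => F i.+1)).
  rewrite -big_nat_recl // [RHS]big_nat_recr //=.
  by rewrite [F n.+1]/F bin_small // mul0r addr0.
rewrite big_ord_recl bin0 -(bin0 n) -/(F 0%N).
under eq_bigr => i _ do rewrite lift0 binS natrD mulrDl -/(F i.+1).
rewrite big_split addrA -sumF -big_split fallingS IHn mulr_suml /=.
apply: eq_bigr => i _; have le_in : (i <= n)%N by rewrite -ltnS ltn_ord.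
by rewrite /F subSS subSn // !fallingS natrB //; ring.
Qed.

(** * Powers of log(1 + x) *)

(** Coefficients below N of a power involve only those of [a] below N. Truncation thus makes
    polynomial algebra and derivatives available. *)
Lemma coef_fps_exp (A : nzRingType) (a : fps A) N m n : (n < N)%N ->
  fps_exp a m n = ((\poly_(i < N) a i) ^+ m)`_n.
Proof.
elim: m n => [|m IHm] n lt_nN; first by rewrite expr0 coef1.
rewrite exprS coefM; apply: eq_bigr => i _.
have le_in : (i <= n)%N by rewrite -ltnS ltn_ord.
by rewrite coef_poly (leq_ltn_trans le_in lt_nN) -IHm // (leq_ltn_trans (leq_subr _ _)).
Qed.

(* The coefficient of x^n in (1 + x) (log^(m+1))' = (m+1) log^m. *)
Lemma fps_exp_log1p_rec (R : realType) m n :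
  n.+1%:R * fps_exp (fps_log1p R) m.+1 n.+1 + n%:R * fps_exp (fps_log1p R) m.+1 n =
  m.+1%:R * fps_exp (fps_log1p R) m n.
Proof.
pose log := fps_log1p R; rewrite -/log.
(* The cut keeps coefficient n + 1 of [log], which differentiation brings into degree n. *)
set N := n.+3; pose L := \poly_(i < N) log i.
(* (1 + x) log' = 1, claimed only through degree n because of the truncation. *)
have dL i : (i <= n)%N -> ((1 + 'X) * L^`())`_i = (i == 0%N)%:R.
  move=> le_in; rewrite mulrDl mul1r coefD coefXM !coef_deriv !coef_poly.
  rewrite (_ : (i.+1 < N)%N); last by rewrite /N !ltnS leqW.
  have C j : (log j.+1) *+ j.+1 = ((-1) ^+ j)%:P.
    by rewrite /= -polyCMn -[X in X%:P]mulr_natr divfK ?pnatr_eq0.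
  rewrite C; case: i le_in => [|i] le_in /=; first by rewrite addr0.
  rewrite (_ : (i.+1 < N)%N); last by rewrite /N !ltnS leqW // ltnW.
  by rewrite C -polyCD exprS mulN1r addNr.
have : ((1 + 'X) * (L ^+ m.+1)^`())`_n = m.+1%:R * (L ^+ m)`_n.
  rewrite deriv_exp /= mulrnAr mulrA coefMn -[LHS]mulr_natl coefM.
  congr (_ * _).
  rewrite big_ord_recl dL // mul1r subn0 big1 ?addr0 // => i _.
  by rewrite lift0 dL ?mul0r // ltn_ord.
rewrite mulrDl mul1r coefD coefXM !coef_deriv.
have lt1_nN : (n.+1 < N)%N by rewrite /N !ltnS.
rewrite (coef_fps_exp _ _ lt1_nN) !(coef_fps_exp _ _ (ltnW lt1_nN)) => <-; rewrite !mulr_natl.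
by congr (_ + _); case: (n).
Qed.

(** Both sides obey the same recurrence in n, by [fps_exp_log1p_rec] and [coef_fallingXS]. This
    expands log(1 + x)^m / m! in signed Stirling numbers of the first kind. *)
Lemma fps_exp_log1p (R : realType) n m :
  n`!%:R * fps_exp (fps_log1p R) m n = m`!%:R * ((falling ('X : {poly R}) n)`_m)%:P.
Proof.
elim: n m => [|n IHn] [|m].
- by rewrite !mul1r coef_fallingX0.
- rewrite mul1r /falling big_ord0 coef1 mulr0 /=.
  by rewrite /fps_mul big_ord1 /= mul0r.
- by rewrite coef_fallingX0 polyC0 !mulr0.
rewrite coef_fallingXS factS natrM -mulrA mulrCA.
have /(canRL (addrK _)) -> := fps_exp_log1p_rec R m n.
rewrite mulrBr !(mulrCA n`!%:R) !IHn factS natrM polyCB polyCM polyC_natr; ring.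
Qed.

(** * The functional L and the poly-Cauchy polynomials *)

(* The functional t^m |-> w m, cut off at degree N so that it is linear by
   construction. *)
Definition umbra (A : nzRingType) (w : nat -> A) (N : nat) (p : {poly A}) : A :=
  \sum_(m < N) p`_m * w m.

Lemma umbraD (A : nzRingType) (w : nat -> A) N : {morph umbra w N : p q / p + q}.
Proof.
move=> p q; rewrite /umbra -big_split; apply: eq_bigr => m _.
by rewrite coefD mulrDl.
Qed.

Lemma umbraZ (A : nzRingType) (w : nat -> A) N a p :
  umbra w N (a *: p) = a * umbra w N p.
Proof.
by rewrite /umbra mulr_sumr; apply: eq_bigr => m _; rewrite coefZ mulrA.
Qed.

Lemma umbra_sum (A : nzRingType) (w : nat -> A) N I (s : seq I) (P : pred I) F :
  umbra w N (\sum_(i <- s | P i) F i) = \sum_(i <- s | P i) umbra w N (F i).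
Proof.
apply: (big_morph _ (umbraD w N)).
by rewrite /umbra big1 // => m _; rewrite coef0 mul0r.
Qed.

Lemma umbra_size (A : nzRingType) (w : nat -> A) N K (p : {poly A}) :
  (size p <= K <= N)%N -> umbra w N p = \sum_(m < K) p`_m * w m.
Proof.
move=> /andP[le_pK le_KN]; rewrite /umbra -!(big_mkord xpredT (fun m => p`_m * w m)).
rewrite (@big_cat_nat _ _ _ K) //= [X in _ + X]big_nat [X in _ + X]big1 ?addr0 //.
by move=> m /andP[le_Km _]; rewrite nth_default ?mul0r // (leq_trans le_pK).
Qed.

(** For w m = 1/(m+1)^k and M = n - r + l this produces the inner sum of the theorem. *)
Lemma umbra_expD (A : comNzRingType) (w : nat -> A) N q M : (M < N)%N ->
  umbra w N ((q%:P + 'X) ^+ M) =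
  \sum_(0 <= i < M.+1) 'C(M, i)%:R * (q ^+ (M - i) * w i).
Proof.
move=> lt_MN; rewrite (@umbra_size _ _ _ M.+1) ?lt_MN ?andbT; last first.
  by rewrite addrC -[q]opprK polyCN size_exp_XsubC.
rewrite big_mkord; apply: eq_bigr => i _; rewrite mulrA; congr (_ * _).
rewrite exprDn coef_sum (bigD1 i) //= big1 ?addr0 => [|j ne_ji].
  by rewrite coefMn -polyC_exp coefCM coefXn eqxx mulr1 mulr_natl.
by rewrite coefMn -polyC_exp coefCM coefXn eq_sym (inj_eq val_inj) (negPf ne_ji) mulr0 mul0rn.
Qed.

(** Substituting u = log(1 + x) in L(e^(tu)) gives L((1 + x)^t), with x^d-coefficient
    L((t)_d)/d!. *)
Lemma fps_comp_Lif_log1p (R : realType) (k : int) N d : (d < N)%N ->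
  fps_comp (Lif R k) (fps_log1p R) d =
  (d`!%:R^-1 * umbra (fun m => (m.+1%:R ^ k)^-1) N (falling 'X d))%:P.
Proof.
move=> lt_dN; rewrite (@umbra_size _ _ _ d.+1) ?size_fallingX ?leqnn //.
rewrite mulr_sumr rmorph_sum; apply: eq_bigr => m _ /=.
have fact_neq0 (j : nat) : (j`!%:R : R) != 0 by rewrite pnatr_eq0 -lt0n fact_gt0.
apply: (@mulfI _ (d`!%:R)); first by rewrite -polyC_natr polyC_eq0.
rewrite mulrCA fps_exp_log1p -!polyC_natr -!polyCM; congr _%:P.
by rewrite mulVKf // invfM mulrACA mulVf // mul1r mulrC.
Qed.

(** The Cauchy product of (1 + x)^q and L((1 + x)^t) matches the Vandermonde expansion of (q + t)_j.
    On the right ['X] is t, whereas in [poly_cauchy] it is z, evaluated at q. *)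
Lemma horner_poly_cauchy (R : realType) (k : int) N q j : (j < N)%N ->
  (poly_cauchy R k j).[q] =
  umbra (fun m => (m.+1%:R ^ k)^-1) N (falling (q%:P + 'X) j).
Proof.
move=> lt_jN; set w := fun m => _.
have fact_neq0 (i : nat) : (i`!%:R : R) != 0 by rewrite pnatr_eq0 -lt0n fact_gt0.
rewrite fallingD umbra_sum /poly_cauchy hornerZ horner_sum mulr_sumr.
apply: eq_bigr => i _; have le_ij : (i <= j)%N by rewrite -ltnS ltn_ord.
rewrite -(rmorph_falling polyC) -polyC_natr !mul_polyC !umbraZ.
rewrite (fps_comp_Lif_log1p R k (leq_ltn_trans (leq_subr i j) lt_jN)) -/w.
rewrite hornerM hornerC hornerZ.
have -> : (\prod_(l < i) ('X - l%:R%:P)).[q] = falling q i.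
  rewrite horner_prod; apply: eq_bigr => l _; exact: hornerXsubC.
by rewrite -(bin_fact le_ij) !natrM; field; rewrite !fact_neq0.
Qed.

(** * From natural numbers to commutative rings, and the theorem *)

(** Otherwise 0, ..., [size p] - 1 would be [size p] distinct roots, more than the degree allows. *)
Lemma poly_eq0_on_nat (A : numDomainType) (p : {poly A}) :
  (forall x : nat, p.[x%:R] = 0) -> p = 0.
Proof.
move=> p_eq0; apply/eqP/negPn/negP => p_neq0.
suff: (size p < size p)%N by rewrite ltnn.
rewrite -{1}(size_iota 0 (size p)) -(size_map (fun x : nat => x%:R : A)).
apply: max_poly_roots => //; first by apply/allP=> _ /mapP[x _ ->]; apply/rootP.
by rewrite map_inj_uniq ?iota_uniq // => x y /eqP; rewrite eqr_nat => /eqP.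
Qed.

Lemma sum_rstirling2_falling (A : comNzRingType) (x : A) n r : (r <= n)%N ->
  \sum_(r <= j < n.+1) (rstirling2 r n j)%:R * falling x j =
  falling x r * x ^+ (n - r).
Proof.
(* The defect of the identity, defined over all commutative rings at once so that it can be
   transported along morphisms. *)
move=> le_rn; pose p (B : comNzRingType) (y : B) :=
  \sum_(r <= j < n.+1) (rstirling2 r n j)%:R * falling y j - falling y r * y ^+ (n - r).
have p_morph (B C : comNzRingType) (f : {rmorphism B -> C}) y : f (p B y) = p C (f y).
  rewrite /p rmorphB rmorphM rmorphXn rmorph_sum rmorph_falling; congr (_ - _).
  by apply: eq_bigr => j _; rewrite rmorphM rmorph_nat rmorph_falling.
have p_nat (B : comNzRingType) (y : nat) : p B y%:R = 0.
  rewrite /p (falling_nat B y r) -natrX -natrM -sum_rstirling2_ffact // natr_sum.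
  apply/eqP; rewrite subr_eq0; apply/eqP/eq_bigr => j _.
  by rewrite (falling_nat B y j) natrM.
(* Over the integers the natural numbers are infinitely many roots; in [A] they may collapse to
   finitely many values. *)
have pX0 : p _ ('X : {poly int}) = 0.
  apply: poly_eq0_on_nat => y; rewrite -[LHS]/(horner_eval _ _) p_morph /= /horner_eval hornerX.
  exact: p_nat.
(* The identity now specializes from {poly int} to any commutative ring. *)
apply/eqP; rewrite -subr_eq0 -/(p A x).
have -> : x = (map_poly intr ('X : {poly int})).[x] by rewrite map_polyX hornerX.
by rewrite -[X in p A X]/(horner_eval x _) -!p_morph pX0 !rmorph0.
Qed.

Theorem theorem5 (R : realType) (n r : nat) (k : int) (q : R)
    (r_ge1 : (1 <= r)%N) (n_ge_r : (r <= n)%N) :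
  \sum_(r <= j < n.+1) (rstirling2 r n j)%:R * (poly_cauchy R k j).[q] =
  \sum_(1 <= l < r.+1) (-1) ^+ (r - l) * (stirling1 r l)%:R *
    \sum_(0 <= i < (n - r + l).+1)
      'C(n - r + l, i)%:R * (q ^+ (n - r + l - i) / i.+1%:R ^ k).
Proof.
pose w m : R := (m.+1%:R ^ k)^-1; pose y : {poly R} := q%:P + 'X.
(* The cutoff n + 1 suffices, as every polynomial in y involved has degree at most n. *)
transitivity (umbra w n.+1 (falling y r * y ^+ (n - r))).
  rewrite -sum_rstirling2_falling // umbra_sum; apply: eq_big_nat => j /andP[_ lt_jn].
  by rewrite -polyC_natr mul_polyC umbraZ (horner_poly_cauchy k q lt_jn).
rewrite (falling_stirling1 _ r_ge1) mulr_suml umbra_sum.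
apply: eq_big_nat => l /andP[_ le_lr].
rewrite -!mulrA -exprD [(l + _)%N]addnC -polyC_natr -[-1](rmorphN1 polyC).
rewrite -polyC_exp !mul_polyC !umbraZ umbra_expD.
  by rewrite mulrA.
(* Since l <= r, the exponent n - r + l stays below the cutoff. *)
by rewrite ltnS -{2}(subnK n_ge_r) leq_add2l.
Qed.
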